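(* For every well-quasi-order $A$, $$1+\mathbf{o}(A)\;\le\;\mathbf{o}(\mathcal{P}_f(A))\;\le\;2^{\mathbf{o}(A)},$$ where the exponentiation is ordinal exponentiation.
   Context: A quasi-order $(A,\le)$ is a well-quasi-order (wqo) if every infinite sequence $x_0,x_1,\dots$ in $A$ has indices $i<j$ with $x_i\le x_j$. For a wqo $A$, let $\mathrm{Bad}(A)$, $\mathrm{Dec}(A)$, $\mathrm{Inco}(A)$ be the trees of finite bad sequences (sequences with no $i<j$, $x_i\le x_j$), finite strictly decreasing sequences, and finite sequences of pairwise incomparable elements of $A$, respectively; the root is the empty sequence and the children of a sequence are its one-element extensions. These trees are well-founded; the rank of a node $s$ is $r(s)=\sup\{r(t)+1 : t \text{ a child of } s\}$ (so $0$ for leaves). The maximal order type $\mathbf{o}(A)$, height $\mathbf{h}(A)$ and width $\mathbf{w}(A)$ are the ranks of the roots of $\mathrm{Bad}(A)$, $\mathrm{Dec}(A)$, $\mathrm{Inco}(A)$ respectively. $\mathcal{P}_f(A)$ denotes the set of finite subsets of $A$ ordered by the Hoare embedding: $S\le_H S'$ iff for every $a\in S$ there is $b\in S'$ with $a\le b$; it is a wqo when $A$ is. *)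

(* Defs.v *)
From Stdlib Require Import List Arith.
Import ListNotations.

(* [Osup K f] denotes the strict supremum  sup { f i + 1 : i in K }. *)
Inductive Ord : Type :=
  | Osup : forall K : Type, (K -> Ord) -> Ord.

Definition oidx (x : Ord) : Type := match x return Type with Osup K _ => K end.
Definition oelt (x : Ord) : oidx x -> Ord :=
  match x return oidx x -> Ord with Osup _ f => f end.

Fixpoint ole (x y : Ord) : Prop :=
  match x with
  | Osup K f => forall i, match y with Osup J g => exists j, ole (f i) (g j) end
  end.

Definition olt (x y : Ord) : Prop :=
  match y with Osup J g => exists j, ole x (g j) end.

Definition ozero : Ord := Osup False (fun e => match e with end).
Definition osucc (x : Ord) : Ord := Osup unit (fun _ => x).
Definition oone : Ord := osucc ozero.

(* (non-strict) supremum of a family: sup_j F j *)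
Definition ojoinf (J : Type) (F : J -> Ord) : Ord :=
  Osup {j : J & oidx (F j)} (fun p => oelt (F (projT1 p)) (projT2 p)).

(* ordinal addition:  x + y = max(x, sup_{b<y} (x + b + 1)) *)
Fixpoint oadd (x y : Ord) : Ord :=
  match y with
  | Osup J g =>
      match x with
      | Osup K f =>
          Osup (K + J) (fun k => match k with
                                 | inl i => f i
                                 | inr j => oadd x (g j)
                                 end)
      end
  end.

(* ordinal exponentiation with base 2:
   2^y = max(1, sup_{b<y} 2^b * 2),  with  2^b * 2 = 2^b + 2^b. *)
Fixpoint oexp2 (y : Ord) : Ord :=
  match y with
  | Osup J g =>
      ojoinf (option J) (fun o => match o with
                                  | None => oone
                                  | Some j => oadd (oexp2 (g j)) (oexp2 (g j))
                                  end)
  end.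

(* [is_rank child x o] : o is the rank of node x, where [child y x] means y is a
   child of x; r(x) = sup { r(y) + 1 : y child of x }. *)
Inductive is_rank {X : Type} (child : X -> X -> Prop) : X -> Ord -> Prop :=
  | is_rank_intro (x : X) (f : {y : X | child y x} -> Ord) :
      (forall y, is_rank child (proj1_sig y) (f y)) ->
      is_rank child x (Osup {y : X | child y x} f).

Definition quasi_order {A : Type} (le : A -> A -> Prop) : Prop :=
  (forall a, le a a) /\ (forall a b c, le a b -> le b c -> le a c).

Definition wqo {A : Type} (le : A -> A -> Prop) : Prop :=
  quasi_order le /\
  forall f : nat -> A, exists i j, i < j /\ le (f i) (f j).

Definition bad {A : Type} (le : A -> A -> Prop) (s : list A) : Prop :=
  forall i j x y, i < j -> nth_error s i = Some x -> nth_error s j = Some y ->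
    ~ le x y.

Definition bad_child {A : Type} (le : A -> A -> Prop) (t s : list A) : Prop :=
  bad le t /\ exists x, t = s ++ [x].

(* [is_mot le o]: o is the maximal order type, the rank of the root of Bad(A) *)
Definition is_mot {A : Type} (le : A -> A -> Prop) (o : Ord) : Prop :=
  is_rank (bad_child le) [] o.

Definition finite_set {A : Type} (S : A -> Prop) : Prop :=
  exists l : list A, forall a, S a <-> In a l.

Definition Pf (A : Type) : Type := {S : A -> Prop | finite_set S}.

Definition hoare {A : Type} (le : A -> A -> Prop) (S S' : Pf A) : Prop :=
  forall a, proj1_sig S a -> exists b, proj1_sig S' b /\ le a b.

(* Main.v *)
Require Import Defs.
From Stdlib Require Import List Arith Lia Classical ClassicalEpsilon.
Import ListNotations.

(** The maximal order type satisfies o(P) = sup { o(P \ ↑x) + 1 : x in P }, so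
    bounds on it are handled by recursion on ordinals through residuals P \ ↑x.

    Lower bound: a bad sequence x_1, ..., x_n of A yields the bad sequence
    {x_1}, ..., {x_n}, ∅ of P_f(A).

    Upper bound: let α = o(A) and proceed by induction on α.
    If α is zero or a limit, then 2^α is closed under natural sums, and the
    residual of P_f(A) at S is the finite union of the P_f(A \ ↑x), x in S, each
    of type at most 2^(o(A \ ↑x)) < 2^α.
    If α = β + 1, some a has o(A \ ↑a) = β.  Every b >= a is equivalent to a:
    otherwise A \ ↑b contains a, hence has type at least β + 1.  So P_f(A) is the
    union of P_f(A \ ↑a) and the sets dominating a, and both reflect into
    P_f(A \ ↑a); thus o(P_f(A)) is at most the natural sum of 2^β with itself.
    This equals 2^β + 2^β because 2^β is a finite multiple of an ordinal closed
    under natural sums. *)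

(** * Order on ordinals *)

Lemma olt_iff x y : olt x y <-> exists j, ole x (oelt y j).
Proof. destruct y; reflexivity. Qed.

Lemma ole_elt x y : ole x y <-> forall i, olt (oelt x i) y.
Proof. destruct x, y; reflexivity. Qed.

Lemma ole_refl x : ole x x.
Proof.
  induction x as [K f IH]; simpl; intro i; exists i; apply IH.
Qed.

Lemma oelt_lt x i : olt (oelt x i) x.
Proof. rewrite olt_iff. exists i. apply ole_refl. Qed.

Lemma ole_trans x y z : ole x y -> ole y z -> ole x z.
Proof.
  revert y z; induction x as [K f IH]; intros [J g] [L h]; simpl; intros H1 H2 i.
  destruct (H1 i) as [j Hj], (H2 j) as [l Hl].
  exists l; eauto.
Qed.

Lemma ole_olt_trans x y z : ole x y -> olt y z -> olt x z.
Proof.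
  rewrite !olt_iff; intros H [j Hj]; exists j; eapply ole_trans; eauto.
Qed.

Lemma olt_ole_trans x y z : olt x y -> ole y z -> olt x z.
Proof.
  rewrite olt_iff, ole_elt; intros [j Hj] H.
  eapply ole_olt_trans; eauto.
Qed.

Lemma ole_ext x y : (forall z, olt z x -> olt z y) -> ole x y.
Proof. intro H; apply ole_elt; intro i; apply H, oelt_lt. Qed.

Lemma olt_ole x y : olt x y -> ole x y.
Proof.
  revert y; induction x as [K f IH]; intros y H; apply ole_elt; intro i; simpl.
  rewrite olt_iff in *; destruct H as [j Hj]; exists j.
  apply IH. apply (proj1 (ole_elt _ _) Hj i).
Qed.

Lemma olt_trans x y z : olt x y -> olt y z -> olt x z.
Proof. intros H1 H2; eapply ole_olt_trans; [apply olt_ole|]; eauto. Qed.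

Lemma olt_wf : well_founded olt.
Proof.
  intro x; cut (forall y, ole y x -> Acc olt y); [eauto using ole_refl|].
  induction x as [K f IH]; intros y Hy; constructor; intros z Hz.
  destruct (olt_ole_trans _ _ _ Hz Hy) as [k Hk]; eauto.
Qed.

(** By classical reasoning: if no branch of [x] is at least [y], then each branch lies below some
    branch of [y], since otherwise the induction hypothesis would put [y] below it. *)
Lemma ole_or_olt x y : ole x y \/ olt y x.
Proof.
  revert y; induction x as [K f IH]; intro y.
  destruct (classic (exists i, ole y (f i))) as [H|H]; [right; exact H|left].
  apply ole_elt; intro i; simpl in *.
  rewrite olt_iff. apply NNPP; intro N. apply H; exists i.
  apply ole_elt; intro j.
  destruct (IH i (oelt y j)) as [Hl|Hl]; [exfalso; apply N; eauto|exact Hl].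
Qed.

Lemma olt_osucc x y : olt x (osucc y) <-> ole x y.
Proof. simpl; split; [intros [_ H]; exact H|intro H; exists tt; exact H]. Qed.

Lemma ole_zero x : ole ozero x.
Proof. apply ole_elt; intros []. Qed.

Lemma olt_zero x : ~ olt x ozero.
Proof. intros [[] _]. Qed.

(** * Addition *)

(** Replaces the branches of [y] by arbitrary smaller ordinals, so that later proofs see only the
    order and not the representation. *)
Lemma olt_oadd z x y :
  olt z (oadd x y) <-> olt z x \/ exists y', olt y' y /\ ole z (oadd x y').
Proof.
  revert z; induction y as [J g IH]; intro z.
  assert (E : olt z (oadd x (Osup J g)) <->
              olt z x \/ exists j, ole z (oadd x (g j))).
  { destruct x as [K f]; split.
    - intros [[i|j] H]; [left; exists i; exact H|right; exists j; exact H].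
    - intros [[i H]|[j H]]; [exists (inl i)|exists (inr j)]; exact H. }
  rewrite E; clear E; split.
  - intros [H|[j H]]; [auto|right; exists (g j); split; [exact (oelt_lt (Osup J g) j)|exact H]].
  - intros [H|[y' [[j Hj] H]]]; [auto|right; exists j].
    eapply ole_trans; [exact H|].
    apply ole_ext; intros w Hw; apply IH.
    destruct y' as [J' g'], x as [K f]; simpl in Hw.
    destruct Hw as [[i|j'] Hw]; [left; exists i; exact Hw|right; exists (g' j')].
    split; [|exact Hw].
    exact (proj1 (ole_elt _ _) Hj j').
Qed.

#[local] Arguments oadd : simpl never.

Lemma oadd_mono_r x y y' : ole y y' -> ole (oadd x y) (oadd x y').
Proof.
  intro H; apply ole_ext; intros z; rewrite !olt_oadd.
  intros [?|[w [? ?]]]; eauto using olt_ole_trans.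
Qed.

Lemma oadd_lt_r x y y' : olt y y' -> olt (oadd x y) (oadd x y').
Proof. intro H; apply olt_oadd; right; exists y; split; [exact H|apply ole_refl]. Qed.

Lemma oadd_mono_l x x' y : ole x x' -> ole (oadd x y) (oadd x' y).
Proof.
  intro H; induction y as [y IH] using (well_founded_ind olt_wf).
  apply ole_ext; intros z; rewrite !olt_oadd.
  intros [?|[w [? ?]]]; [eauto using olt_ole_trans|].
  right; exists w; split; [assumption|]; eapply ole_trans; eauto.
Qed.

Lemma oadd_mono x x' y y' : ole x x' -> ole y y' -> ole (oadd x y) (oadd x' y').
Proof. eauto using ole_trans, oadd_mono_l, oadd_mono_r. Qed.

Lemma ole_oadd_l x y : ole x (oadd x y).
Proof. apply ole_ext; intros z Hz; apply olt_oadd; auto. Qed.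

Lemma ole_oadd_r x y : ole y (oadd x y).
Proof.
  induction y as [y IH] using (well_founded_ind olt_wf).
  apply ole_ext; intros z Hz; apply olt_oadd; eauto.
Qed.

Lemma oadd_zero_r x y : ole y ozero -> ole (oadd x y) x.
Proof.
  intro H; apply ole_ext; intros z; rewrite olt_oadd.
  intros [?|[w [Hw _]]]; [assumption|].
  destruct (olt_zero w); eapply olt_ole_trans; eauto.
Qed.

Lemma oadd_zero_l x : ole (oadd ozero x) x.
Proof.
  induction x as [x IH] using (well_founded_ind olt_wf).
  apply ole_ext; intros z Hz; apply olt_oadd in Hz.
  destruct Hz as [Hz|[y [Hy Hz]]]; [destruct (olt_zero _ Hz)|].
  eauto using ole_trans, ole_olt_trans.
Qed.

(** [ole] is only a preorder on terms, so an identity of ordinals becomes two inequalities. *)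
Lemma oadd_assoc_l x y z : ole (oadd (oadd x y) z) (oadd x (oadd y z)).
Proof.
  induction z as [z IH] using (well_founded_ind olt_wf).
  apply ole_ext; intros w; rewrite olt_oadd; intros [H|[z' [Hz Hw]]].
  - eapply olt_ole_trans; [exact H|]; apply oadd_mono_r, ole_oadd_l.
  - eapply ole_olt_trans; [eapply ole_trans; [exact Hw|apply IH, Hz]|].
    apply oadd_lt_r, oadd_lt_r, Hz.
Qed.

Lemma oadd_assoc_r x y z : ole (oadd x (oadd y z)) (oadd (oadd x y) z).
Proof.
  induction z as [z IH] using (well_founded_ind olt_wf).
  apply ole_ext; intros w; rewrite olt_oadd; intros [H|[v [Hv Hw]]].
  - eapply olt_ole_trans; [exact H|]; eauto using ole_trans, ole_oadd_l.
  - apply olt_oadd in Hv; destruct Hv as [Hv|[z' [Hz Hv]]].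
    + apply olt_oadd; left; apply olt_oadd; eauto.
    + eapply ole_olt_trans; [exact Hw|].
      eapply ole_olt_trans; [apply oadd_mono_r, Hv|].
      eapply ole_olt_trans; [apply IH, Hz|]; apply oadd_lt_r, Hz.
Qed.

(** * Natural sum *)

(** The Hessenberg sum, as the least operation strictly increasing in both arguments. The inner
    [fix] handles the calls that keep [x] and lower [y]. *)
Fixpoint nadd (x : Ord) : Ord -> Ord :=
  match x with
  | Osup K f =>
      fix nadd_x (y : Ord) : Ord :=
        match y with
        | Osup J g => Osup (K + J) (fun k => match k with
                                             | inl i => nadd (f i) y
                                             | inr j => nadd_x (g j)
                                             end)
        end
  end.

Lemma olt_nadd_elt z x y :
  olt z (nadd x y) <->
  (exists i, ole z (nadd (oelt x i) y)) \/ (exists j, ole z (nadd x (oelt y j))).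
Proof.
  destruct x as [K f], y as [J g]; split.
  - intros [[i|j] H]; [left; exists i|right; exists j]; exact H.
  - intros [[i H]|[j H]]; [exists (inl i)|exists (inr j)]; exact H.
Qed.

Lemma nadd_mono x x' y y' : ole x x' -> ole y y' -> ole (nadd x y) (nadd x' y').
Proof.
  revert y x' y'; induction x as [K f IHx].
  induction y as [J g IHy]; intros x' y' Hx Hy.
  apply ole_ext; intros z Hz; apply olt_nadd_elt; apply olt_nadd_elt in Hz.
  destruct Hz as [[i Hz]|[j Hz]]; simpl in Hz.
  - left. pose proof (proj1 (ole_elt _ _) Hx i) as H.
    rewrite olt_iff in H; destruct H as [i' H]; exists i'; simpl in H.
    eapply ole_trans; [exact Hz|]; apply IHx; assumption.
  - right. pose proof (proj1 (ole_elt _ _) Hy j) as H.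
    rewrite olt_iff in H; destruct H as [j' H]; exists j'; simpl in H.
    eapply ole_trans; [exact Hz|]; apply IHy; assumption.
Qed.

Lemma olt_nadd z x y :
  olt z (nadd x y) <->
  (exists x', olt x' x /\ ole z (nadd x' y)) \/
  (exists y', olt y' y /\ ole z (nadd x y')).
Proof.
  rewrite olt_nadd_elt; split.
  - intros [[i H]|[j H]]; [left|right]; eexists; (split; [apply oelt_lt|exact H]).
  - intros [[x' [Hx H]]|[y' [Hy H]]]; [left|right].
    + rewrite olt_iff in Hx; destruct Hx as [i Hi]; exists i.
      eapply ole_trans; [exact H|]; apply nadd_mono; auto using ole_refl.
    + rewrite olt_iff in Hy; destruct Hy as [j Hj]; exists j.
      eapply ole_trans; [exact H|]; apply nadd_mono; auto using ole_refl.
Qed.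

Lemma nadd_zero x y : ole x ozero -> ole y ozero -> ole (nadd x y) ozero.
Proof.
  intros Hx Hy; eapply ole_trans; [apply nadd_mono; eassumption|].
  apply ole_ext; intros z; rewrite olt_nadd.
  intros [[w [H _]]|[w [H _]]]; destruct (olt_zero w H).
Qed.

(** These are the ordinals $\omega^\gamma$. *)
Definition nadd_closed (e : Ord) : Prop :=
  olt ozero e /\ forall x y, olt x e -> olt y e -> olt (nadd x y) e.

Fixpoint omuln (e : Ord) (n : nat) : Ord :=
  match n with 0 => ozero | S n => oadd (omuln e n) e end.

Lemma omuln_mono e m n : m <= n -> ole (omuln e m) (omuln e n).
Proof.
  induction 1; [apply ole_refl|]; simpl; eauto using ole_trans, ole_oadd_l.
Qed.

Lemma omuln_add e m n :
  ole (omuln e (m + n)) (oadd (omuln e m) (omuln e n)) /\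
  ole (oadd (omuln e m) (omuln e n)) (omuln e (m + n)).
Proof.
  induction n as [|n [IH1 IH2]]; simpl.
  - rewrite Nat.add_0_r; split; [apply ole_oadd_l|apply oadd_zero_r, ole_refl].
  - rewrite Nat.add_succ_r; simpl; split.
    + eapply ole_trans; [apply oadd_mono_l, IH1|apply oadd_assoc_l].
    + eapply ole_trans; [apply oadd_assoc_r|apply oadd_mono_l, IH2].
Qed.

(** A weak division with remainder by [e]; an upper bound is enough, because [nadd] is monotone. *)
Lemma olt_omuln e m x :
  olt x (omuln e m) ->
  exists k c, k < m /\ olt c e /\ ole x (oadd (omuln e k) c).
Proof.
  induction m as [|m IH]; simpl omuln; intro H.
  - destruct (olt_zero _ H).
  - apply olt_oadd in H; destruct H as [H|[c [Hc H]]].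
    + destruct (IH H) as (k & c & Hk & Hc & Hx); exists k, c; auto.
    + exists m, c; auto.
Qed.

(** In Cantor normal form the natural sum adds the coefficients of [e] and sums the remainders.
    Lexicographic induction on [N], [c], [d]: going below a summand lowers either its remainder or
    its number of copies of [e]. *)
Lemma nadd_omuln_le e (He : nadd_closed e) :
  forall N m n c d, m + n = N -> olt c e -> olt d e ->
  ole (nadd (oadd (omuln e m) c) (oadd (omuln e n) d))
      (oadd (omuln e N) (nadd c d)).
Proof.
  induction N as [N IHN] using (well_founded_ind lt_wf); intros m n c.
  revert m n; induction c as [c IHc] using (well_founded_ind olt_wf); intros m n d.
  revert m n; induction d as [d IHd] using (well_founded_ind olt_wf).
  intros m n HN Hc Hd; apply ole_ext; intros z Hz.
  (* When copies are lost, the new remainders are arbitrary below [e], but their natural sum stays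
     below [e] and fits into one of the lost copies. *)
  assert (Hsmall : forall M c' d', M < N -> olt c' e -> olt d' e ->
            ole z (oadd (omuln e M) (nadd c' d')) ->
            olt z (oadd (omuln e N) (nadd c d))).
  { intros M c' d' HM Hc' Hd' H.
    eapply ole_olt_trans; [exact H|].
    eapply olt_ole_trans; [apply oadd_lt_r, (proj2 He); eassumption|].
    change (oadd (omuln e M) e) with (omuln e (S M)).
    eapply ole_trans; [apply omuln_mono, HM|apply ole_oadd_l]. }
  apply olt_nadd in Hz; destruct Hz as [[x [Hx Hz]]|[y [Hy Hz]]].
  - apply olt_oadd in Hx; destruct Hx as [Hx|[c' [Hc' Hx]]].
    + apply olt_omuln in Hx; destruct Hx as (k & c' & Hk & Hc' & Hx).
      apply (Hsmall (k + n) c' d); [lia|assumption|assumption|].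
      eapply ole_trans; [exact Hz|].
      eapply ole_trans; [apply nadd_mono; [exact Hx|apply ole_refl]|].
      apply IHN; auto; lia.
    + eapply ole_olt_trans; [exact Hz|].
      eapply ole_olt_trans; [apply nadd_mono; [exact Hx|apply ole_refl]|].
      eapply ole_olt_trans; [apply IHc; eauto using olt_trans|].
      apply oadd_lt_r, olt_nadd; left; exists c'; split; [assumption|apply ole_refl].
  - apply olt_oadd in Hy; destruct Hy as [Hy|[d' [Hd' Hy]]].
    + apply olt_omuln in Hy; destruct Hy as (k & d' & Hk & Hd' & Hy).
      apply (Hsmall (m + k) c d'); [lia|assumption|assumption|].
      eapply ole_trans; [exact Hz|].
      eapply ole_trans; [apply nadd_mono; [apply ole_refl|exact Hy]|].
      apply IHN; auto; lia.
    + eapply ole_olt_trans; [exact Hz|].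
      eapply ole_olt_trans; [apply nadd_mono; [apply ole_refl|exact Hy]|].
      eapply ole_olt_trans; [apply IHd; eauto using olt_trans|].
      apply oadd_lt_r, olt_nadd; right; exists d'; split; [assumption|apply ole_refl].
Qed.

(** The shape $\omega^\gamma\cdot m$ of every power of two, for which natural and ordinary doubling
    agree. *)
Definition closed_multiple (x : Ord) : Prop :=
  exists e m, nadd_closed e /\ ole x (omuln e m) /\ ole (omuln e m) x.

Lemma closed_multiple_double x : closed_multiple x -> closed_multiple (oadd x x).
Proof.
  intros (e & m & He & H1 & H2); exists e, (m + m); split; [exact He|].
  destruct (omuln_add e m m) as [H3 H4]; split.
  - eapply ole_trans; [apply oadd_mono; exact H1|exact H4].
  - eapply ole_trans; [exact H3|apply oadd_mono; exact H2].
Qed.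

Lemma nadd_diag_le x : closed_multiple x -> ole (nadd x x) (oadd x x).
Proof.
  intros (e & m & He & H1 & H2).
  assert (Hm : ole x (oadd (omuln e m) ozero))
    by (eapply ole_trans; [exact H1|apply ole_oadd_l]).
  eapply ole_trans; [apply nadd_mono; exact Hm|].
  eapply ole_trans; [apply nadd_omuln_le with (N := m + m); auto; apply He|].
  eapply ole_trans; [apply oadd_zero_r, nadd_zero; apply ole_refl|].
  eapply ole_trans; [apply omuln_add|apply oadd_mono; exact H2].
Qed.

(** * Powers of two *)

Lemma olt_oexp2_elt z y :
  olt z (oexp2 y) <->
  ole z ozero \/ exists j, olt z (oadd (oexp2 (oelt y j)) (oexp2 (oelt y j))).
Proof.
  destruct y as [J g]; simpl oelt; split.
  - intros [[[j|] i] H]; simpl in H.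
    + right; exists j; apply olt_iff; eauto.
    + left; exact H.
  - intros [H|[j H]].
    + exists (existT _ None tt); exact H.
    + apply olt_iff in H; destruct H as [i H].
      exists (existT _ (Some j) i); exact H.
Qed.

Lemma oexp2_mono x y : ole x y -> ole (oexp2 x) (oexp2 y).
Proof.
  revert y; induction x as [K f IH]; intros y H.
  apply ole_ext; intros z; rewrite !olt_oexp2_elt.
  intros [Hz|[i Hz]]; [auto|right; simpl in Hz].
  pose proof (proj1 (ole_elt _ _) H i) as Hi; apply olt_iff in Hi.
  destruct Hi as [j Hj]; exists j.
  eapply olt_ole_trans; [exact Hz|]; apply oadd_mono; apply IH, Hj.
Qed.

Lemma oexp2_pos x : olt ozero (oexp2 x).
Proof. apply olt_oexp2_elt; left; apply ole_refl. Qed.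

Lemma olt_oexp2 z y :
  olt z (oexp2 y) <->
  ole z ozero \/ exists b, olt b y /\ olt z (oadd (oexp2 b) (oexp2 b)).
Proof.
  rewrite olt_oexp2_elt; split; (intros [H|H]; [auto|right]).
  - destruct H as [j H]; eexists; split; [apply oelt_lt|exact H].
  - destruct H as [b [Hb H]]; apply olt_iff in Hb; destruct Hb as [j Hj]; exists j.
    eapply olt_ole_trans; [exact H|]; apply oadd_mono; apply oexp2_mono, Hj.
Qed.

Lemma oexp2_double_le b y :
  olt b y -> ole (oadd (oexp2 b) (oexp2 b)) (oexp2 y).
Proof. intro H; apply ole_ext; intros z Hz; apply olt_oexp2; eauto. Qed.

Lemma oexp2_lt b y : olt b y -> olt (oexp2 b) (oexp2 y).
Proof.
  intro H; eapply olt_ole_trans; [|apply oexp2_double_le, H].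
  eapply ole_olt_trans; [apply ole_oadd_l|].
  apply oadd_lt_r, oexp2_pos.
Qed.

(** Two ordinals below $2^y$ lie below a common $2^b$ with $b<y$; their natural sum is at most
    $2^b+2^b\le 2^{b+1}<2^y$. *)
Lemma oexp2_closed y :
  (forall b, olt b y -> closed_multiple (oexp2 b)) ->
  (forall b, olt b y -> olt (osucc b) y) -> nadd_closed (oexp2 y).
Proof.
  intros Hm Hlim; split; [apply oexp2_pos|].
  (* The first alternative covers $y=0$, where no [b] exists. *)
  assert (Hbelow : forall z, olt z (oexp2 y) ->
            ole z ozero \/ exists b, olt b y /\ ole z (oexp2 b)).
  { intros z Hz; apply olt_oexp2 in Hz; destruct Hz as [Hz|[b [Hb Hz]]]; [auto|].
    right; exists (osucc b); split; [auto|].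
    eapply ole_trans; [apply olt_ole, Hz|].
    apply oexp2_double_le, olt_osucc, ole_refl. }
  assert (Hsum : forall u v b, olt b y -> ole u (oexp2 b) -> ole v (oexp2 b) ->
            olt (nadd u v) (oexp2 y)).
  { intros u v b Hb Hu Hv.
    eapply ole_olt_trans; [apply nadd_mono; eassumption|].
    eapply ole_olt_trans; [apply nadd_diag_le, Hm, Hb|].
    eapply ole_olt_trans; [apply oexp2_double_le, olt_osucc, ole_refl|].
    apply oexp2_lt, Hlim, Hb. }
  intros u v Hu Hv.
  destruct (Hbelow u Hu) as [Hu0|[b [Hb Hub]]], (Hbelow v Hv) as [Hv0|[c [Hc Hvc]]].
  - eapply ole_olt_trans; [apply nadd_zero; assumption|apply oexp2_pos].
  - apply (Hsum u v c); auto; eapply ole_trans; [exact Hu0|apply ole_zero].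
  - apply (Hsum u v b); auto; eapply ole_trans; [exact Hv0|apply ole_zero].
  - destruct (ole_or_olt b c) as [H|H]; [|apply olt_ole in H].
    + apply (Hsum u v c); auto; eapply ole_trans; [exact Hub|apply oexp2_mono, H].
    + apply (Hsum u v b); auto; eapply ole_trans; [exact Hvc|apply oexp2_mono, H].
Qed.

(** Zero falls under the first alternative. *)
Lemma limit_or_succ y :
  (forall b, olt b y -> olt (osucc b) y) \/ (exists b, olt b y /\ ole y (osucc b)).
Proof.
  destruct (classic (exists b, olt b y /\ ole y (osucc b))) as [H|H]; [auto|left].
  intros b Hb; destruct (ole_or_olt y (osucc b)) as [Hl|Hl]; [|exact Hl].
  exfalso; eauto.
Qed.

Lemma oexp2_succ_le b : ole (oexp2 (osucc b)) (oadd (oexp2 b) (oexp2 b)).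
Proof.
  apply ole_ext; intros z Hz; apply olt_oexp2_elt in Hz.
  destruct Hz as [Hz|[[] Hz]]; [|exact Hz].
  eapply ole_olt_trans; [exact Hz|].
  eapply olt_ole_trans; [apply oexp2_pos|apply ole_oadd_l].
Qed.

(** At zero and at limits the power is itself closed, so one copy suffices; at a successor the
    number of copies of the same [e] doubles. *)
Lemma oexp2_closed_multiple y : closed_multiple (oexp2 y).
Proof.
  induction y as [y IH] using (well_founded_ind olt_wf).
  destruct (limit_or_succ y) as [H|(b & Hb & Hy)].
  - exists (oexp2 y), 1; split; [apply oexp2_closed; auto|split; simpl].
    + apply ole_oadd_r.
    + apply oadd_zero_l.
  - destruct (closed_multiple_double _ (IH b Hb)) as (e & m & He & H1 & H2).
    exists e, m; split; [exact He|split].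
    + eapply ole_trans; [apply oexp2_mono, Hy|].
      eapply ole_trans; [apply oexp2_succ_le|exact H1].
    + eapply ole_trans; [exact H2|apply oexp2_double_le, Hb].
Qed.

(** * Bounds on maximal order types through residuals *)

Section Residuals.
Context {A : Type} (le : A -> A -> Prop).

(** Says $\mathbf{o}(P)\le o$ by recursion on [o], so that it applies to any subset before a rank is
    known to exist: every move [x] is answered by a branch of [o] bounding the residual. *)
Fixpoint mot_le (P : A -> Prop) (o : Ord) : Prop :=
  match o with
  | Osup K f =>
      forall x, P x -> exists k, mot_le (fun y => P y /\ ~ le x y) (f k)
  end.

(** The dual bound $o\le\mathbf{o}(P)$: every branch of [o] is answered by a move [x]. *)
Fixpoint mot_ge (P : A -> Prop) (o : Ord) : Prop :=
  match o with
  | Osup K f =>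
      forall k, exists x, P x /\ mot_ge (fun y => P y /\ ~ le x y) (f k)
  end.

Lemma mot_le_subset (P Q : A -> Prop) o :
  (forall x, P x -> Q x) -> mot_le Q o -> mot_le P o.
Proof.
  revert P Q; induction o as [K f IH]; simpl; intros P Q HPQ H x Hx.
  destruct (H x (HPQ x Hx)) as [k Hk]; exists k.
  eapply IH; [|exact Hk]; simpl; intuition.
Qed.

Lemma mot_ge_subset (P Q : A -> Prop) o :
  (forall x, P x -> Q x) -> mot_ge P o -> mot_ge Q o.
Proof.
  revert P Q; induction o as [K f IH]; simpl; intros P Q HPQ H k.
  destruct (H k) as (x & Hx & Hk); exists x; split; [auto|].
  eapply IH; [|exact Hk]; simpl; intuition.
Qed.

Lemma mot_le_elt P o :
  mot_le P o <->
  forall x, P x -> exists i, mot_le (fun y => P y /\ ~ le x y) (oelt o i).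
Proof. destruct o; reflexivity. Qed.

Lemma mot_le_weaken P o o' : ole o o' -> mot_le P o -> mot_le P o'.
Proof.
  revert P o'; induction o as [K f IH]; intros P o' Ho H.
  apply mot_le_elt; intros x Hx; destruct (H x Hx) as [k Hk].
  pose proof (proj1 (ole_elt _ _) Ho k) as Hj; apply olt_iff in Hj.
  destruct Hj as [j Hj]; exists j; eauto.
Qed.

Lemma mot_le_iff P o :
  mot_le P o <->
  forall x, P x -> exists o', olt o' o /\ mot_le (fun y => P y /\ ~ le x y) o'.
Proof.
  rewrite mot_le_elt; split; intros H x Hx; destruct (H x Hx) as [i Hi].
  - eexists; split; [apply oelt_lt|exact Hi].
  - destruct Hi as [Hi H']; apply olt_iff in Hi; destruct Hi as [j Hj].
    exists j; eapply mot_le_weaken; eassumption.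
Qed.

(** The two strategies play against each other: the move answering branch [k] of [o] is itself
    answered by a branch of [o'], and both continue on the same residual. *)
Lemma mot_ge_le P o o' : mot_ge P o -> mot_le P o' -> ole o o'.
Proof.
  revert P o'; induction o as [K f IH]; intros P o' Hge Hle.
  apply ole_elt; intro k; apply olt_iff; simpl.
  destruct (Hge k) as (x & Hx & Hk).
  destruct (proj1 (mot_le_elt _ _) Hle x Hx) as [j Hj]; eauto.
Qed.

(** A move in one part lowers the bound of that part, while the other part can only shrink; this is
    the recursion of [nadd]. *)
Lemma mot_le_union P Q o o' :
  mot_le P o -> mot_le Q o' -> mot_le (fun x => P x \/ Q x) (nadd o o').
Proof.
  revert P Q o'; induction o as [K f IHo]; intros P Q o'; revert P Q.
  induction o' as [J g IHo']; intros P Q HP HQ x [Hx|Hx].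
  - destruct (HP x Hx) as [k Hk]; exists (inl k).
    eapply mot_le_subset; [|apply IHo; [exact Hk|]].
    + intros y [[Hy|Hy] Hn]; [left; auto|right; exact (conj Hy Hn)].
    + eapply mot_le_subset; [|exact HQ]; simpl; intuition.
  - destruct (HQ x Hx) as [j Hj]; exists (inr j).
    eapply mot_le_subset; [|apply (IHo' j); [|exact Hj]].
    + intros y [[Hy|Hy] Hn]; [left; exact (conj Hy Hn)|right; auto].
    + eapply mot_le_subset; [|exact HP]; simpl; intuition.
Qed.

Lemma bad_snoc s x :
  bad le (s ++ [x]) <-> bad le s /\ forall y, In y s -> ~ le y x.
Proof.
  split; [intro H; split|intros [H1 H2]].
  - intros i j u v Hij Hu Hv; apply (H i j u v Hij).
    + rewrite nth_error_app1; [exact Hu|apply nth_error_Some; congruence].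
    + rewrite nth_error_app1; [exact Hv|apply nth_error_Some; congruence].
  - intros y Hy; apply In_nth_error in Hy; destruct Hy as [i Hi].
    assert (Hl : i < length s) by (apply nth_error_Some; congruence).
    apply (H i (length s) y x Hl).
    + rewrite nth_error_app1; assumption.
    + rewrite nth_error_app2, Nat.sub_diag by lia; reflexivity.
  - intros i j u v Hij Hu Hv.
    assert (Hj : j < length (s ++ [x])) by (apply nth_error_Some; congruence).
    rewrite length_app in Hj; simpl in Hj.
    rewrite nth_error_app1 in Hu by lia.
    destruct (Nat.eq_dec j (length s)) as [->|Hn].
    + rewrite nth_error_app2, Nat.sub_diag in Hv by lia.
      injection Hv as <-; apply H2; eapply nth_error_In; eassumption.
    + rewrite nth_error_app1 in Hv by lia; eauto.
Qed.

Lemma bad_nil : bad le [].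
Proof. intros [|i] j x y _ H; discriminate H. Qed.

(** The elements by which a bad sequence [s] can be extended to a bad sequence. *)
Definition residual (s : list A) (y : A) : Prop := forall x, In x s -> ~ le x y.

Lemma residual_snoc s x y :
  residual (s ++ [x]) y <-> residual s y /\ ~ le x y.
Proof.
  unfold residual; split.
  - intro H; split; [intros z Hz|]; apply H, in_or_app; simpl; auto.
  - intros [H1 H2] z Hz; apply in_app_or in Hz.
    destruct Hz as [Hz|[<-|[]]]; auto.
Qed.

(** Children of [s] correspond to the elements [x] of its residual, and appending [x] removes
    exactly $\uparrow x$ from that residual. *)
Lemma rank_residual s o :
  is_rank (bad_child le) s o -> bad le s ->
  mot_le (residual s) o /\ mot_ge (residual s) o.
Proof.
  induction 1 as [s f Hf IH]; intro Hs; split; simpl.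
  - intros x Hx.
    assert (Hc : bad_child le (s ++ [x]) s)
      by (split; [apply bad_snoc; auto|eauto]).
    exists (exist (fun t => bad_child le t s) _ Hc).
    eapply mot_le_subset; [|apply IH, Hc].
    intros y Hy; apply residual_snoc, Hy.
  - intros [t Ht]; pose proof Ht as [Hbad [x ->]].
    exists x; split; [exact (proj2 (proj1 (bad_snoc _ _) Hbad))|].
    eapply mot_ge_subset; [|apply (IH (exist (fun t => bad_child le t s) _ Ht)), Hbad].
    intros y Hy; apply residual_snoc, Hy.
Qed.

Lemma mot_bounds o :
  is_mot le o -> mot_le (fun _ => True) o /\ mot_ge (fun _ => True) o.
Proof.
  intro H; destruct (rank_residual _ _ H bad_nil) as [H1 H2]; split.
  - eapply mot_le_subset; [|exact H1]; intros y _ x [].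
  - eapply mot_ge_subset; [|exact H2]; auto.
Qed.

(** The rank is computed by recursion on the accessibility proof. *)
Lemma acc_rank {X : Type} (child : X -> X -> Prop) x :
  Acc child x -> exists o, is_rank child x o.
Proof.
  intro a.
  pose (rank := fix rank x (a : Acc child x) : Ord :=
    Osup {y | child y x} (fun y => rank _ (Acc_inv a (proj2_sig y)))).
  exists (rank x a); revert x a.
  fix IH 2; intros x [h]; simpl; constructor; intro y; apply IH.
Qed.

(** The bound acts as a measure: each extension of [s] passes to a branch of [o]. *)
Lemma mot_le_acc s o : mot_le (residual s) o -> Acc (bad_child le) s.
Proof.
  revert s; induction o as [K f IH]; intros s H; constructor.
  intros t [Ht [x ->]]; apply bad_snoc in Ht.
  destruct (H x (proj2 Ht)) as [k Hk]; apply (IH k).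
  eapply mot_le_subset; [|exact Hk]; intro y; apply residual_snoc.
Qed.

Lemma mot_le_exists o : mot_le (fun _ => True) o -> exists o', is_mot le o'.
Proof.
  intro H; apply acc_rank, (mot_le_acc [] o).
  eapply mot_le_subset; [|exact H]; intros y _; exact I.
Qed.

(** If the root were not accessible, choosing inaccessible children forever would give an infinite
    sequence whose finite prefixes are all bad. *)
Lemma wqo_mot_exists : wqo le -> exists o, is_mot le o.
Proof.
  intros [_ Hw]; apply acc_rank, NNPP; intro N.
  pose (T := {s | ~ Acc (bad_child le) s}).
  assert (Hnext : forall s : T, exists x,
    bad le (proj1_sig s ++ [x]) /\ ~ Acc (bad_child le) (proj1_sig s ++ [x])).
  { intros [s Hs]; simpl; apply NNPP; intro H; apply Hs; constructor.
    intros t [Ht [x ->]]; apply NNPP; eauto. }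
  pose (nx := fun s => proj1_sig (constructive_indefinite_description _ (Hnext s))).
  assert (Hnx : forall s : T, bad le (proj1_sig s ++ [nx s]) /\
                 ~ Acc (bad_child le) (proj1_sig s ++ [nx s]))
    by (intro s; exact (proj2_sig (constructive_indefinite_description _ (Hnext s)))).
  pose (g := fix g n : T := match n with
     | 0 => exist _ [] N
     | S n => exist _ (proj1_sig (g n) ++ [nx (g n)]) (proj2 (Hnx (g n)))
     end).
  assert (Hlen : forall n, length (proj1_sig (g n)) = n).
  { induction n as [|n IH]; [reflexivity|].
    simpl; rewrite length_app; simpl; lia. }
  assert (Hnth : forall n i, i < n ->
            nth_error (proj1_sig (g n)) i = Some (nx (g i))).
  { induction n as [|n IH]; intros i Hi; [lia|].
    simpl proj1_sig; destruct (Nat.eq_dec i n) as [->|Hn].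
    - rewrite nth_error_app2, Hlen, Nat.sub_diag by (rewrite Hlen; lia); reflexivity.
    - rewrite nth_error_app1 by (rewrite Hlen; lia); apply IH; lia. }
  destruct (Hw (fun n => nx (g n))) as (i & j & Hij & Hle).
  (* The prefix of length [S j] is the first to contain both entries [i] and [j]. *)
  assert (Hb : bad le (proj1_sig (g (S j)))) by apply Hnx.
  apply (Hb i j (nx (g i)) (nx (g j)) Hij); auto.
Qed.

End Residuals.

(** An order-reflecting map sends bad sequences to bad sequences. *)
Lemma mot_le_reflect {A B : Type} (leA : A -> A -> Prop) (leB : B -> B -> Prop)
  (f : A -> B) (P : A -> Prop) (Q : B -> Prop) o :
  (forall x, P x -> Q (f x)) ->
  (forall x y, P x -> P y -> leB (f x) (f y) -> leA x y) ->
  mot_le leB Q o -> mot_le leA P o.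
Proof.
  revert P Q; induction o as [K g IH]; simpl; intros P Q HPQ Hr H x Hx.
  destruct (H (f x) (HPQ x Hx)) as [k Hk]; exists k.
  eapply IH; [| |exact Hk]; simpl.
  - intros y [Hy Hn]; split; auto.
  - intros y z [Hy _] [Hz _]; auto.
Qed.

(** * Finitary powerset *)

Section Powerset.
Context {A : Type} (le : A -> A -> Prop).

Lemma finite_empty : finite_set (fun _ : A => False).
Proof. exists []; simpl; intuition. Qed.

Definition pf_empty : Pf A := exist _ _ finite_empty.

Lemma finite_singleton (x : A) : finite_set (eq x).
Proof. exists [x]; simpl; intuition. Qed.

Definition pf_singleton (x : A) : Pf A := exist _ (eq x) (finite_singleton x).

Lemma finite_filter (S Q : A -> Prop) :
  finite_set S -> finite_set (fun x => S x /\ Q x).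
Proof.
  intros [l Hl].
  cut (exists l', forall a, In a l' <-> In a l /\ Q a).
  { intros [l' Hl']; exists l'; intro a; rewrite Hl', Hl; reflexivity. }
  clear Hl; induction l as [|x l [l' IH]]; [exists []; simpl; tauto|].
  destruct (classic (Q x)) as [Hx|Hx].
  - exists (x :: l'); intro a; simpl; rewrite IH; intuition (subst; auto).
  - exists l'; intro a; simpl; rewrite IH; intuition (subst; tauto).
Qed.

Definition pf_filter (Q : A -> Prop) (S : Pf A) : Pf A :=
  exist _ (fun x => proj1_sig S x /\ Q x) (finite_filter _ Q (proj2_sig S)).

(** $\mathcal{P}_f(P)$ as a predicate on $\mathcal{P}_f(A)$, so that residuals of [P] require no
    subtypes. *)
Definition pf_of (P : A -> Prop) (S : Pf A) : Prop := forall x, proj1_sig S x -> P x.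

(** The conditions on [Q] survive a move $\{x\}$, which embeds neither in $\emptyset$ nor in $\{y\}$
    when $x\not\le y$. *)
Lemma mot_ge_powerset (P : A -> Prop) (Q : Pf A -> Prop) o :
  Q pf_empty -> (forall x, P x -> Q (pf_singleton x)) ->
  mot_ge le P o -> mot_ge (hoare le) Q (oadd oone o).
Proof.
  revert P Q; induction o as [J g IH]; intros P Q Q0 Q1 H [[]|j].
  (* The summand 1 is the final move $\emptyset$; its branch is zero and asks nothing of the
     residual. *)
  - exists pf_empty; split; [exact Q0|intros []].
  - destruct (H j) as (x & Hx & Hj); exists (pf_singleton x); split; [auto|].
    eapply IH; [| |exact Hj]; simpl.
    + split; [exact Q0|].
      intro Hh; destruct (Hh x eq_refl) as [b [[] _]].
    + intros y [Hy Hn]; split; [auto|].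
      intro Hh; destruct (Hh x eq_refl) as [b [Hb Hl]]; simpl in Hb; subst b; auto.
Qed.

(** Splits the residual at [S] into the pieces $\mathcal{P}_f(A\setminus\uparrow x)$ for $x\in
    S$. *)
Lemma not_hoare S S' :
  ~ hoare le S S' -> exists x, proj1_sig S x /\ forall y, proj1_sig S' y -> ~ le x y.
Proof.
  intro H; apply NNPP; intro N; apply H; intros a Ha.
  apply NNPP; intro N'; apply N; exists a; split; [exact Ha|].
  intros y Hy Hl; eauto.
Qed.

Lemma mot_le_powerset_limit P o :
  nadd_closed (oexp2 o) -> mot_le le P o ->
  (forall b Q, olt b o -> mot_le le Q b -> mot_le (hoare le) (pf_of Q) (oexp2 b)) ->
  mot_le (hoare le) (pf_of P) (oexp2 o).
Proof.
  intros Hc H IH; apply mot_le_iff; intros S HS.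
  destruct (proj2_sig S) as [l Hl].
  (* The residual becomes a union indexed by the list [l], ready for induction on [l]. *)
  cut (exists o', olt o' (oexp2 o) /\
         mot_le (hoare le)
           (fun S' => pf_of P S' /\
              exists x, In x l /\ forall y, proj1_sig S' y -> ~ le x y) o').
  { intros (o' & Ho' & H'); exists o'; split; [exact Ho'|].
    eapply mot_le_subset; [|exact H']; intros S' [HS' Hn]; split; [exact HS'|].
    destruct (not_hoare _ _ Hn) as (x & Hx & Hy); exists x; split; [|exact Hy].
    apply Hl, Hx. }
  assert (HP : forall x, In x l -> P x) by (intros x Hx; apply HS, Hl, Hx).
  clear HS Hl; induction l as [|a l IHl].
  - exists ozero; split; [apply Hc|].
    intros S' [_ [x [[] _]]].
  - destruct IHl as (o1 & Ho1 & H1); [intros; apply HP; simpl; auto|].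
    destruct (proj1 (mot_le_iff _ _ _) H a) as (b & Hb & Ha); [apply HP; simpl; auto|].
    (* $2^b$ bounds the piece of [a] and [o1] the remaining ones; closure keeps the sum below
       $2^o$. *)
    exists (nadd (oexp2 b) o1); split; [apply Hc; [apply oexp2_lt|]; assumption|].
    eapply mot_le_subset; [|apply mot_le_union; [apply IH; [exact Hb|exact Ha]|exact H1]].
    intros S' [HS' [x [[<-|Hx] Hy]]]; [left|right; eauto].
    intros y Hy'; auto.
Qed.

(** Among sets dominating [a], deleting the elements above [a] reflects the embedding, as [a] is
    maximal up to equivalence. *)
Lemma mot_le_powerset_succ P a b (Hq : quasi_order le) :
  P a -> (forall c, P c -> le a c -> le c a) ->
  mot_le (hoare le) (pf_of (fun y => P y /\ ~ le a y)) (oexp2 b) ->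
  mot_le (hoare le) (pf_of P) (oadd (oexp2 b) (oexp2 b)).
Proof.
  intros Ha Hmax H.
  eapply mot_le_weaken; [apply nadd_diag_le, oexp2_closed_multiple|].
  eapply mot_le_subset;
    [|apply mot_le_union; [exact H|
        eapply (mot_le_reflect _ _ (pf_filter (fun y => ~ le a y))
                 (fun S => pf_of P S /\ exists c, proj1_sig S c /\ le a c)); [| |exact H]]].
  - intros S HS; destruct (classic (exists c, proj1_sig S c /\ le a c)) as [Hc|Hc].
    + right; auto.
    + left; intros x Hx; split; [auto|eauto].
  - intros S [HS _] x [Hx Hn]; auto.
  - intros S S' [HS _] [HS' [c [Hc Hac]]] Hh x Hx.
    destruct (classic (le a x)) as [Hax|Hax].
    (* A deleted element satisfies $x\le a\le c$ by maximality. *)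
    + exists c; split; [exact Hc|]; apply (proj2 Hq) with a; auto.
    + destruct (Hh x (conj Hx Hax)) as [y [[Hy _] Hxy]]; eauto.
Qed.

Lemma mot_le_powerset (Hq : quasi_order le) o P :
  mot_le le P o -> mot_le (hoare le) (pf_of P) (oexp2 o).
Proof.
  revert P; induction o as [o IH] using (well_founded_ind olt_wf); intros P H.
  destruct (limit_or_succ o) as [Hlim|(b & Hb & Ho)].
  - apply mot_le_powerset_limit; auto.
    apply oexp2_closed; auto using oexp2_closed_multiple.
  - destruct (classic (mot_le le P b)) as [HPb|HPb].
    + eapply mot_le_weaken; [apply olt_ole, oexp2_lt, Hb|auto].
    + assert (Hres : forall x, P x -> mot_le le (fun y => P y /\ ~ le x y) b).
      { intros x Hx; destruct (proj1 (mot_le_iff _ _ _) H x Hx) as (c & Hc & Hx').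
        eapply mot_le_weaken; [|exact Hx'].
        apply olt_osucc; eapply olt_ole_trans; eassumption. }
      (* Since $\mathbf{o}(P)\le b$ fails, some residual has type exactly [b]. *)
      assert (Ha : exists a, P a /\
                ~ exists c, olt c b /\ mot_le le (fun y => P y /\ ~ le a y) c).
      { apply NNPP; intro N; apply HPb, mot_le_iff; intros x Hx.
        apply NNPP; eauto. }
      destruct Ha as (a & Ha & Hexact).
      eapply mot_le_weaken; [apply oexp2_double_le, Hb|].
      apply mot_le_powerset_succ with a; auto.
      (* If $a\le c\not\le a$, then [a] is a move in $P\setminus\uparrow c$, of type at most [b].
         The residual after it has type below [b] and contains $P\setminus\uparrow a$, against the
         choice of [a]. *)
      intros c Hc Hac; apply NNPP; intro Hca; apply Hexact.
      destruct (proj1 (mot_le_iff _ _ _) (Hres c Hc) a (conj Ha Hca)) as (d & Hd & H').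
      exists d; split; [exact Hd|].
      eapply mot_le_subset; [|exact H'].
      intros y [Hy Hn]; repeat split; auto.
      intro Hcy; apply Hn; apply (proj2 Hq) with c; auto.
Qed.

End Powerset.

(** * Existence of both types and the two inequalities *)

Theorem mainTheorem1 (A : Type) (le : A -> A -> Prop) (HA : wqo le) :
  (exists oA, is_mot le oA) /\
  (exists oP, is_mot (@hoare A le) oP) /\
  (forall oA oP, is_mot le oA -> is_mot (@hoare A le) oP ->
     ole (oadd oone oA) oP /\ ole oP (oexp2 oA)).
Proof.
  assert (Hup : forall oA, is_mot le oA ->
            mot_le (hoare le) (fun _ => True) (oexp2 oA)).
  { intros oA H.
    eapply mot_le_subset; [|apply (mot_le_powerset le (proj1 HA)), mot_bounds, H].
    intros S _ x _; exact I. }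
  destruct (wqo_mot_exists le HA) as [o Ho].
  (* The upper bound itself makes the tree of bad sequences of $\mathcal{P}_f(A)$ well-founded, so
     its rank exists. *)
  split; [eauto|split; [eapply mot_le_exists, Hup, Ho|]].
  intros oA oP HoA HoP.
  destruct (mot_bounds _ _ HoA) as [_ HgeA], (mot_bounds _ _ HoP) as [HleP HgeP]; split.
  - eapply mot_ge_le; [|exact HleP].
    apply (mot_ge_powerset le (fun _ => True)); auto.
  - eapply mot_ge_le; [exact HgeP|apply Hup, HoA].
Qed.
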